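(* Let $P$ be a finite atomic lattice and let $\mathcal{M}=\{m_p\}_{p\in P}$ be a labeling of $P$ by monomials satisfying the following two conditions: (1) if $p\in\mathrm{mi}(P)$ then $m_p\neq 1$; (2) if $\gcd(m_p,m_q)\neq 1$ for some $p,q\in P$, then $p$ and $q$ are comparable in $P$. Then $\mathcal{M}$ is a coordinatization of $P$; that is, the LCM lattice of the monomial ideal $M_{P,\mathcal{M}}$ is isomorphic to $P$.
   Context: A finite lattice $P$ has a minimum $\hat 0$ and a maximum $\hat 1$. An atom is an element covering $\hat 0$; $\mathrm{atoms}(P)$ is the set of atoms. $P$ is a finite atomic lattice if every element of $P\setminus\{\hat 0\}$ is a join of atoms. An element $x\in P$, $x\ne\hat 1$, is meet-irreducible if $x\neq a\wedge b$ for all $a>x$, $b>x$; $\mathrm{mi}(P)$ is the set of meet-irreducible elements. For $x\in P$ put $\lceil x\rceil=\{a\in P : x\le a\}$, and let $\lceil x\rceil^c=P\setminus\lceil x\rceil$. A labeling of $P$ is an assignment of non-trivial monomials (in a polynomial ring $R$ over a field in finitely many variables) to some set of elements of $P$; elements which are not assigned a monomial are regarded as having label $1$, so a labeling is a family $\mathcal{M}=\{m_p\}_{p\in P}$ of monomials. Given a labeling $\mathcal{M}$, $M_{P,\mathcal{M}}$ is the monomial ideal generated by the monomials $x(a)=\prod_{p\in\lceil a\rceil^c}m_p$ for $a\in\mathrm{atoms}(P)$. The LCM lattice of a monomial ideal is the set of least common multiples of all subsets of its minimal monomial generators (with $1$ the lcm of the empty set), ordered by divisibility. A labeling $\mathcal{M}$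 is a coordinatization of $P$ if the LCM lattice of $M_{P,\mathcal{M}}$ is isomorphic to $P$. *)

(* Defs.v *)
From mathcomp Require Import all_boot all_order all_algebra.
From mathcomp Require Import finmap.
From mathcomp.multinomials Require Import mpoly.

Set Implicit Arguments.
Unset Strict Implicit.
Unset Printing Implicit Defensive.

Import Order.TTheory GRing.Theory.

Section FiniteLattices.
Context {d : Order.disp_t} (P : finTBLatticeType d).
Local Open Scope order_scope.

Definition atoms : {set P} :=
  [set a | (\bot < a) && [forall x : P, ~~ ((\bot < x) && (x < a))]].

Definition atomic_lattice : Prop :=
  forall x : P, x != \bot ->
    exists2 A : {set P}, A \subset atoms & x = \join_(a in A) a.

Definition meet_irreducible (x : P) : Prop :=
  x != \top /\ forall a b : P, x < a -> x < b -> x <> a `&` b.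

End FiniteLattices.

(* A monomial in n variables is its exponent vector m : 'X_{1..n}: 0%MM is the
   monomial 1, addition of exponents is multiplication of monomials, and
   (m1 <= m2)%MM is divisibility. *)
Section Monomials.
Variable n : nat.
Local Open Scope fset_scope.

Definition mgcd (m1 m2 : 'X_{1..n}) : 'X_{1..n} :=
  [multinom minn (m1 i) (m2 i) | i < n].

Definition mlcms (S : {fset 'X_{1..n}}) : 'X_{1..n} :=
  \big[@mlcm n/0%MM]_(m <- S) m.

End Monomials.

Section MonomialIdeals.
Variables (k : fieldType) (n : nat).
Local Open Scope fset_scope.
Local Open Scope ring_scope.

Definition monomial_ideal (G : {fset 'X_{1..n}}) (p : {mpoly k[n]}) : Prop :=
  exists c : 'X_{1..n} -> {mpoly k[n]}, p = \sum_(m <- G) c m * 'X_[m].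

Definition monomials_generate (G : {fset 'X_{1..n}})
    (I : {mpoly k[n]} -> Prop) : Prop :=
  forall p, I p <-> monomial_ideal G p.

Definition minimal_monomial_generators (I : {mpoly k[n]} -> Prop)
    (G : {fset 'X_{1..n}}) : Prop :=
  monomials_generate G I /\
  forall H : {fset 'X_{1..n}}, H `<=` G -> monomials_generate H I -> H = G.

(* For a monomial ideal the set G below exists and is unique: see
   minimal_monomial_generators_exists and minimal_monomial_generators_uniq. *)
Definition lcm_lattice (I : {mpoly k[n]} -> Prop) (m : 'X_{1..n}) : Prop :=
  exists2 G : {fset 'X_{1..n}}, minimal_monomial_generators I G &
    exists2 S : {fset 'X_{1..n}}, S `<=` G & m = mlcms S.

End MonomialIdeals.

(* An isomorphism of posets between two lattices is a lattice isomorphism. *)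
Definition lattice_isomorphic_to_monomials {d : Order.disp_t}
    (P : finTBLatticeType d) (n : nat) (L : 'X_{1..n} -> Prop) : Prop :=
  exists f : P -> 'X_{1..n},
    [/\ injective f,
        forall m, L m <-> exists x, f x = m
      & forall x y, (x <= y)%O = (f x <= f y)%MM].

(* A labeling is a map m : P -> 'X_{1..n}, the value 0%MM (the monomial 1)
   meaning that an element carries no label. *)
Section Coordinatizations.
Context {d : Order.disp_t} (P : finTBLatticeType d).
Variables (n : nat) (m : P -> 'X_{1..n}).
Local Open Scope fset_scope.

Definition atom_monomial (a : P) : 'X_{1..n} :=
  (\sum_(p | ~~ (a <= p)%O) m p)%MM.

Definition labeling_ideal (k : fieldType) : {mpoly k[n]} -> Prop :=
  monomial_ideal (k := k) [fset atom_monomial a | a in atoms P].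

Definition coordinatization (k : fieldType) : Prop :=
  lattice_isomorphic_to_monomials P (lcm_lattice (@labeling_ideal k)).

End Coordinatizations.

Section MinimalGenerators.
Variables (k : fieldType) (n : nat).
Local Open Scope fset_scope.
Local Open Scope ring_scope.
Implicit Types (G H : {fset 'X_{1..n}}) (m g : 'X_{1..n}).

Lemma monomial_idealD G (p q : {mpoly k[n]}) :
  monomial_ideal G p -> monomial_ideal G q -> monomial_ideal G (p + q).
Proof.
move=> [c ->] [e ->]; exists (fun m => c m + e m).
by rewrite -big_split; apply: eq_bigr => m _ /=; rewrite mulrDl.
Qed.

Lemma monomial_idealM G (r p : {mpoly k[n]}) :
  monomial_ideal G p -> monomial_ideal G (r * p).
Proof.
move=> [c ->]; exists (fun m => r * c m).
by rewrite big_distrr; apply: eq_bigr => m _ /=; rewrite mulrA.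
Qed.

Lemma monomial_ideal_gen G g : g \in G -> monomial_ideal G ('X_[g] : {mpoly k[n]}).
Proof.
move=> gG; exists (fun m => (m == g)%:R).
rewrite (big_rem g) //= eqxx mul1r big_seq big1 ?addr0 // => m.
rewrite mem_rem_uniq ?fset_uniq // inE => /andP[/negPf ->]; by rewrite mul0r.
Qed.

Lemma monomial_ideal_monomialP G m :
  monomial_ideal G ('X_[m] : {mpoly k[n]}) <-> exists2 g, g \in G & (g <= m)%MM.
Proof.
split=> [[c E]|[g gG le_gm]]; last first.
  by rewrite -(submK le_gm) mpolyXD; apply/monomial_idealM/monomial_ideal_gen.
have [/hasP[g gG le_gm]|/hasPn N] := boolP (has (fun g => (g <= m)%MM) G).
  by exists g.
have /eqP := congr1 (fun p : {mpoly k[n]} => p@_m) E.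
rewrite mcoeffX eqxx raddf_sum /= big_seq big1 ?oner_eq0 // => g gG.
apply/memN_msupp_eq0/negP; rewrite (perm_mem (msuppMX _ _)).
by case/mapP=> m' _ Em; have := N g gG; rewrite Em lem_addr.
Qed.

Lemma monomial_ideal_sub G H :
  (forall g, g \in G -> exists2 h, h \in H & (h <= g)%MM) ->
  forall p : {mpoly k[n]}, monomial_ideal G p -> monomial_ideal H p.
Proof.
move=> GH p [c ->]; rewrite big_seq; apply: big_ind => [||g gG].
- exists (fun _ => 0); by rewrite big1 // => m _; rewrite mul0r.
- exact: monomial_idealD.
- by apply/monomial_idealM/monomial_ideal_monomialP/GH.
Qed.

Lemma minimal_monomial_generators_exists G :
  exists H, minimal_monomial_generators (@monomial_ideal k n G) H.
Proof.
suff: forall N H, (#|` H| <= N)%N -> monomials_generate H (@monomial_ideal k n G) ->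
    exists H', minimal_monomial_generators (@monomial_ideal k n G) H'.
  by move=> /(_ _ G (leqnn _)); apply.
elim=> [|N IH] H leN gH.
  exists H; split=> // H' sH' _; move: leN sH'.
  by rewrite leqn0 => /eqP/cardfs0_eq ->; rewrite fsubset0 => /eqP.
have [/existsP[[g gH'] /= dv]|no] := boolP [exists g : H, has (fun h => (h <= val g)%MM) (H `\ val g)].
  apply: (IH (H `\ g)).
    by rewrite -ltnS; apply: leq_trans leN; rewrite (cardfsD1 g H) gH'.
  move=> p; rewrite gH; split; apply: monomial_ideal_sub => m; last first.
    by rewrite in_fsetD1 => /andP[_ mH]; exists m; rewrite ?lepm_refl.
  move=> mH; have [->|ne] := eqVneq m g.
    by case/hasP: dv => h hH le; exists h.
  by exists m; rewrite ?lepm_refl // in_fsetD1 ne.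
exists H; split=> // H' sH' gen'; apply/eqP; rewrite eqEfsubset sH' /=.
apply/fsubsetP => g gH'; apply/negPn/negP => gN.
case/existsP: no; exists [` gH']; apply/hasP => /=.
have /gH/gen'/monomial_ideal_monomialP[h hH' le] := monomial_ideal_gen gH'.
exists h => //; rewrite in_fsetD1 (fsubsetP sH') // andbT.
by apply: contraNneq gN => <-.
Qed.

Lemma minimal_monomial_generators_uniq (I : {mpoly k[n]} -> Prop) G H :
  minimal_monomial_generators I G -> minimal_monomial_generators I H -> G = H.
Proof.
suff sub G1 G2 : minimal_monomial_generators I G1 ->
    minimal_monomial_generators I G2 -> G1 `<=` G2.
  by move=> mG mH; apply/eqP; rewrite eqEfsubset !sub.
move=> [g1 min1] [g2 _]; apply/fsubsetP => g gG.
have /g1/g2/monomial_ideal_monomialP[h hG le_hg] := monomial_ideal_gen gG.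
have /g2/g1/monomial_ideal_monomialP[g' g'G le_g'h] := monomial_ideal_gen hG.
have le_g'g := lepm_trans le_g'h le_hg.
have [E|ne] := eqVneq g' g.
  suff -> : g = h by [].
  by apply/mnmP=> i; apply/eqP; rewrite eqn_leq -{1}E (mnm_lepP le_g'h) (mnm_lepP le_hg).
have gen : monomials_generate (G1 `\ g) I.
  move=> p; rewrite g1; split; apply: monomial_ideal_sub => m; last first.
    by rewrite in_fsetD1 => /andP[_ mH]; exists m; rewrite ?lepm_refl.
  move=> mG; have [->|ne'] := eqVneq m g.
    by exists g'; rewrite // in_fsetD1 ne.
  by exists m; rewrite ?lepm_refl // in_fsetD1 ne'.
by move: gG; rewrite -(min1 _ (fsubD1set _ _) gen) in_fsetD1 eqxx.
Qed.

End MinimalGenerators.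

(* Main.v *)
Require Import Defs.
From HB Require Import structures.
From mathcomp Require Import all_boot all_order all_algebra.
From mathcomp Require Import finmap.
From mathcomp.multinomials Require Import mpoly.

(** Extend [x(a)] from atoms to all of [P] by [x(a) = \prod_(p | ~ a <= p) m_p].
    Comparability of labels that share a variable makes [x] a morphism from
    joins to lcms ([atom_monomial_join]): fix a variable and look at the chain
    of the elements whose label involves it.  On that chain, the elements above
    [a] and those above [b] are two up-sets, so one contains the other.  The
    elements failing to be above [a \/ b] are then exactly those failing to be
    above one of [a], [b], and the exponent for the join is the larger of the
    two exponents.

    The nontrivial labels on meet-irreducibles make [x] reflect the order
    ([atom_monomial_le]).  If [x(a)] divides [x(b)], then [x(a \/ b) = x(b)];
    were [b] strictly below [a \/ b], some meet-irreducible would be above [b]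
    but not above [a \/ b], and its label would divide the quotient
    [x(a \/ b) / x(b)].

    Since atoms are pairwise incomparable, so are their monomials, hence these
    are the minimal generators of the ideal ([atom_monomials_minimal]).  As
    every element of [P] is a join of atoms, the lcms of sets of generators are
    exactly the values of [x]. *)

Set Implicit Arguments.
Unset Strict Implicit.
Unset Printing Implicit Defensive.

Import Order.TTheory.

(** Any maximal element among those above [b] and not above [a] is
    meet-irreducible: if it were the meet of two larger elements, both would be
    above [a] by maximality, and so would be their meet. *)
Lemma meet_irreducible_separation (d : Order.disp_t) (P : finTBLatticeType d)
    (a b : P) : ~~ (a <= b)%O ->
  exists p : P, [/\ meet_irreducible p, (b <= p)%O & ~~ (a <= p)%O].
Proof.
move=> nab; pose sep := [pred p : P | (b <= p)%O && ~~ (a <= p)%O].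
have sep_b : sep b by rewrite /= lexx.
(* A largest number of elements below [p] forces [p] to be maximal. *)
case: (@arg_maxnP P b sep (fun p => #|[set q | (q <= p)%O]|) sep_b).
move=> p /andP[bp nap] max_p.
have above (c : P) : (p < c)%O -> (a <= c)%O.
  move=> pc; apply: contraT => nac.
  have /max_p /= : sep c by rewrite /= nac (le_trans bp (ltW pc)).
  rewrite /geq /= leqNgt => /negP[]; apply: proper_card; apply/properP; split.
    by apply/subsetP => q; rewrite !inE => /le_trans -> //; apply: ltW.
  by exists c; rewrite !inE ?lexx // lt_geF.
exists p; split=> //; split; first by apply: contraNneq nap => ->; apply: lex1.
by move=> u v /above au /above av E; rewrite E lexI au av in nap.
Qed.

Lemma atom_le_eq (d : Order.disp_t) (P : finTBLatticeType d) (a b : P) :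
  a \in atoms P -> b \in atoms P -> (b <= a)%O -> b = a.
Proof.
rewrite !inE => /andP[_ /forallP/(_ b)] + /andP[b0 _] ba.
by rewrite b0 /= lt_neqAle ba andbT negbK => /eqP.
Qed.

Section Lcm.
Variable n : nat.
Implicit Types u v w : 'X_{1..n}.

Lemma mlcm_exp u v i : mlcm u v i = maxn (u i) (v i).
Proof. by rewrite mlcmE mnmDE mnmBE -maxnE. Qed.

Lemma mlcmA : associative (@mlcm n).
Proof. by move=> u v w; apply/mnmP => i; rewrite !mlcm_exp maxnA. Qed.

(** This structure is what allows lcms over finite sets to be reindexed. *)
HB.instance Definition _ :=
  Monoid.isComLaw.Build 'X_{1..n} 0%MM (@mlcm n) mlcmA (@mlcmC n) (@mlc0m n).

End Lcm.

Section LabelProducts.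
Context {d : Order.disp_t} (P : finTBLatticeType d).
Variables (n : nat) (m : P -> 'X_{1..n}).
Implicit Types (a b : P) (i : 'I_n).
Local Notation x := (atom_monomial m).

Lemma atom_monomialE a i : x a i = \sum_(p | ~~ (a <= p)%O) m p i.
Proof. exact: mnm_sumE. Qed.

(** The exponent of a variable depends only on the elements whose label involves
    it, so the order relations need to be compared on these alone. *)
Lemma atom_monomial_exp_le a b i :
  (forall p : P, m p i != 0 -> (b <= p)%O -> (a <= p)%O) -> x a i <= x b i.
Proof.
move=> sub; rewrite !atom_monomialE big_mkcond [leqRHS]big_mkcond.
apply: leq_sum => p _; have [->|/sub] := eqVneq (m p i) 0; first by rewrite !if_same.
by case: (b <= p)%O => [->|] //=; case: ifP.
Qed.

Lemma atom_monomial_homo a b : (a <= b)%O -> (x a <= x b)%MM.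
Proof.
move=> ab; apply/mnm_lepP => i; apply: atom_monomial_exp_le => p _.
exact: le_trans.
Qed.

Lemma atom_monomial0 : x \bot%O = 0%MM.
Proof. by rewrite /atom_monomial big1 // => p; rewrite le0x. Qed.

Hypothesis gcd_comparable :
  forall p q : P, mgcd (m p) (m q) <> 0%MM -> (p >=< q)%O.

Lemma shared_variable_comparable i (p q : P) :
  m p i != 0 -> m q i != 0 -> (p >=< q)%O.
Proof.
move=> mp mq; apply: gcd_comparable => /mnmP/(_ i)/eqP.
by rewrite mnmE mnm0E -leqn0 geq_min !leqn0 (negPf mp) (negPf mq).
Qed.

(** Up-sets of a chain are nested; here the chain consists of the elements whose
    label involves the [i]-th variable. *)
Lemma up_sets_nested a b i :
  (forall p : P, m p i != 0 -> (b <= p)%O -> (a <= p)%O) \/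
  (forall p : P, m p i != 0 -> (a <= p)%O -> (b <= p)%O).
Proof.
have [/existsP[q /and3P[mq bq naq]]|no] :=
  boolP [exists q : P, [&& m q i != 0, (b <= q)%O & ~~ (a <= q)%O]].
  right=> p mp ap; have /orP[pq|] := shared_variable_comparable mp mq.
    by rewrite (le_trans ap pq) in naq.
  exact: le_trans.
left=> p mp bp; apply: contraNT no => nap.
by apply/existsP; exists p; rewrite mp bp.
Qed.

(** In each variable, one of [a], [b] has the smaller up-set on the chain.  That
    up-set is also the one of the join, and a smaller up-set means a larger
    exponent. *)
Lemma atom_monomial_join a b : x (a `|` b)%O = mlcm (x a) (x b).
Proof.
apply/mnmP => i; rewrite mlcm_exp; apply/eqP; rewrite eqn_leq geq_max.
have /mnm_lepP -> := atom_monomial_homo (leUl a b).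
have /mnm_lepP -> := atom_monomial_homo (leUr b a).
rewrite !andbT leq_max.
apply/orP; case: (up_sets_nested a b i) => sub; [right|left];
  apply: atom_monomial_exp_le => p mp cp; rewrite leUx cp ?andbT.
  exact: sub.
exact: sub.
Qed.

Hypothesis label_mi : forall p : P, meet_irreducible p -> m p <> 0%MM.

(** Divisibility makes the exponents of [x (a `|` b)] and [x b] agree, and the
    label of any meet-irreducible separating [a] from [b] counts in the former
    only. *)
Lemma atom_monomial_le a b : (x a <= x b)%MM = (a <= b)%O.
Proof.
apply/idP/idP; last exact: atom_monomial_homo.
move=> xab; apply: contraT => nab.
have [p [/label_mi mp bp nap]] := meet_irreducible_separation nab.
case: mp; apply/mnmP => i; rewrite mnm0E; apply/eqP; rewrite -leqn0.
have : x (a `|` b)%O i <= x b i.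
  by rewrite atom_monomial_join mlcm_exp geq_max leqnn (mnm_lepP xab).
rewrite !atom_monomialE (bigD1 p) /=; last by rewrite leUx negb_and nap.
(* [s] collects the factors of [x (a `|` b)] other than [m p]; those of [x b]
   are among them because [p] is above [b]. *)
set s := (X in _ + X <= _) => le_s.
suff rest : \sum_(q | ~~ (b <= q)%O) m q i <= s.
  by rewrite -(leq_add2r s) add0n (leq_trans le_s).
rewrite /s big_mkcond [leqRHS]big_mkcond; apply: leq_sum => q _.
case: ifP => // nbq; rewrite leUx negb_and nbq orbT /=.
by case: eqVneq nbq => [->|//]; rewrite bp.
Qed.

Lemma atom_monomial_inj : injective x.
Proof.
by move=> a b E; apply/le_anti; rewrite -!atom_monomial_le E lepm_refl.
Qed.

Lemma mlcms_atom_monomial (A : {set P}) :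
  mlcms [fset x a | a in A]%fset = x (\join_(a in A) a)%O.
Proof.
rewrite (big_morph _ atom_monomial_join atom_monomial0) /mlcms.
rewrite (big_imfset _ _ id) /=; last by move=> a b _ _; apply: atom_monomial_inj.
by rewrite big_enum.
Qed.

(** A generating subset has to contain a divisor of each [x a]; this divisor is
    [x b] for an atom [b] below [a], so it is [x a] itself. *)
Lemma atom_monomials_minimal (k : fieldType) :
  minimal_monomial_generators (@labeling_ideal d P n m k)
    [fset x a | a in atoms P]%fset.
Proof.
split=> // H HG gen; apply/eqP; rewrite eqEfsubset HG /=.
apply/fsubsetP => _ /imfsetP[a /= a_at ->].
have /gen/monomial_ideal_monomialP[h hH] :
    labeling_ideal m ('X_[x a] : {mpoly k[n]})%R.
  by apply: monomial_ideal_gen; apply/imfsetP; exists a.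
have /imfsetP[b /= b_at E] := fsubsetP HG h hH.
by rewrite E atom_monomial_le => /(atom_le_eq a_at b_at) <-; rewrite -E.
Qed.

Lemma lcm_lattice_atom_monomial (k : fieldType) : atomic_lattice P ->
  forall u, lcm_lattice (@labeling_ideal d P n m k) u <-> exists a, x a = u.
Proof.
move=> atomicP u; split=> [[G minG [S SG ->]]|[a <-]].
  rewrite (minimal_monomial_generators_uniq minG (atom_monomials_minimal k)) in SG.
  (* Distinct atoms have distinct monomials, so a set of generators is the
     image of a set of atoms, and its lcm is the monomial of their join. *)
  exists (\join_(a in [set a in atoms P | x a \in S]) a)%O.
  rewrite -mlcms_atom_monomial; congr mlcms; apply/fsetP => v.
  apply/imfsetP/idP => [[b /=] |vS]; first by rewrite inE => /andP[_ bS] ->.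
  have /imfsetP[b /= b_at E] := fsubsetP SG v vS.
  by exists b; rewrite //= inE b_at -E.
exists [fset x a | a in atoms P]%fset; first exact: atom_monomials_minimal.
(* The bottom element is the join of the empty set of atoms. *)
have [A A_at ->] : exists2 A : {set P}, A \subset atoms P & a = (\join_(b in A) b)%O.
  have [->|/atomicP //] := eqVneq a \bot%O.
  by exists set0; rewrite ?sub0set // big_set0.
exists [fset x b | b in A]%fset; last by rewrite mlcms_atom_monomial.
apply/fsubsetP => _ /imfsetP[b /= bA ->]; apply/imfsetP.
by exists b; rewrite //= (subsetP A_at).
Qed.
End LabelProducts.

Theorem theorem3p1 (d : Order.disp_t) (P : finTBLatticeType d)
    (k : fieldType) (n : nat) (m : P -> 'X_{1..n}) :
  atomic_lattice P ->
  (forall p : P, meet_irreducible p -> m p <> 0%MM) ->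
  (forall p q : P, mgcd (m p) (m q) <> 0%MM -> (p >=< q)%O) ->
  coordinatization m k.
Proof.
move=> atomicP label_mi gcd_comparable; exists (atom_monomial m); split.
- exact: atom_monomial_inj.
- exact: lcm_lattice_atom_monomial.
- by move=> a b; rewrite atom_monomial_le.
Qed.
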